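(* Let $\sigma$ be a sigmoidal function and let $\varphi$ be a convex $\varphi$-function satisfying the $\Delta'$-condition and such that $u\mapsto u^{-\beta}\varphi(u)$, $u>0$, is increasing, for some $\beta>1$. Assume $M^\varphi_{0,1}(\phi_\sigma)<+\infty$. Let $L\ge1$ be the constant of the equivalence between $\varphi$ and a $\varphi$-function $\psi$ with $\psi^{1/\beta}$ convex, i.e. $\psi(t/L)\le\varphi(t)\le\psi(Lt)$ for all $t\ge0$, and let $\psi^{\sigma,\varphi}>0$ be a constant such that $I^\varphi[\lambda(K_nf-f)]\le\psi^{\sigma,\varphi}\, I^\varphi\left[\frac{2L^2\lambda}{n}f'\right]$ for all $f\in W^{1,\varphi}(I)$, $\lambda>0$ and $n\in\mathbb N$ (such a constant exists under these assumptions). Set $M:=\max\{1,\psi^{\sigma,\varphi}\}$. Then, for every $f\in W^{1,\varphi}(I)$ and $n\in\mathbb N$, $$\|K_nf-f\|_\varphi\le M\,\frac{2L^2}{n}\,\|f'\|_\varphi.$$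
   Context: Let $I=[a,b]\subset\mathbb R$ with $a<b$. Sigmoidal functions. A measurable $\sigma:\mathbb R\to\mathbb R$ is sigmoidal if $\lim_{x\to-\infty}\sigma(x)=0$ and $\lim_{x\to+\infty}\sigma(x)=1$. Here every sigmoidal function is assumed non-decreasing, with $\sigma(1)<1$, and to satisfy: (S1) $\sigma(x)-1/2$ is an odd function; (S2) $\sigma\in C^2(\mathbb R)$ is concave for $x\ge 0$; (S3) $\sigma(x)=\mathcal O(|x|^{-\alpha-1})$ as $x\to-\infty$ for some $\alpha>0$. The density function is $\phi_\sigma(x):=\frac12[\sigma(x+1)-\sigma(x-1)]$, $x\in\mathbb R$. Operators. For $f:I\to\mathbb R$ locally integrable and $n\in\mathbb N$ with $\lceil na\rceil\le\lfloor nb\rfloor-1$ (this is assumed of every $n$ considered), $$(K_nf)(x)=\frac{\sum_{k=\lceil na\rceil}^{\lfloor nb\rfloor-1}\left[n\int_{k/n}^{(k+1)/n}f(u)\,du\right]\phi_\sigma(nx-k)}{\sum_{k=\lceil na\rceil}^{\lfloor nb\rfloor-1}\phi_\sigma(nx-k)},\quad x\in I.$$ Orlicz spaces. A $\varphi$-function is a continuous non-decreasing $\varphi:[0,\infty)\to[0,\infty)$ with $\varphi(0)=0$, $\varphi(u)>0$ for $u>0$, $\lim_{u\to\infty}\varphi(u)=+\infty$. For measurable $f$ on $I$, $I^\varphi[f]:=\int_I\varphi(|f(x)|)\,dx$; $L^\varphi(I)$ is the set of measurable $f$ on $I$ with $I^\varphi[\lambda f]<+\infty$ for some $\lambda>0$.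 The Luxemburg norm is $\|f\|_\varphi:=\inf\{u>0: I^\varphi[f/u]\le1\}$. The Sobolev-Orlicz space is $W^{1,\varphi}(I):=\{f\in AC(I): f'\in L^\varphi(I)\}$, where $AC(I)$ is the space of absolutely continuous functions $I\to\mathbb R$. $\Delta'$-condition: there exists $C'_\varphi>0$ such that $\varphi(uv)\le C'_\varphi\,\varphi(u)\varphi(v)$ for all $u\ge0$ and $v\ge1$. Moments: for $\nu,\mu\ge0$, $M^\varphi_{\nu,\mu}(\phi_\sigma):=\sup_{u\in\mathbb R}\sum_{k\in\mathbb Z}\phi_\sigma(u-k)\,|u-k|^\nu\,\varphi(|u-k|^\mu)$; so $M^\varphi_{0,1}(\phi_\sigma)=\sup_{u\in\mathbb R}\sum_{k\in\mathbb Z}\phi_\sigma(u-k)\,\varphi(|u-k|)$. It is known (Hästö) that if $u\mapsto u^{-\beta}\varphi(u)$ is increasing on $(0,\infty)$ for some $\beta>1$, then there are a $\varphi$-function $\psi$ and $L\ge1$ with $\psi(t/L)\le\varphi(t)\le\psi(Lt)$ for $t\ge0$ and $\psi^{1/\beta}$ convex, where $\psi^{1/\beta}(x):=(\psi(x))^{1/\beta}$. *)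

(* Defs.v *)
From mathcomp Require Export all_boot all_order all_algebra.
From mathcomp Require Export all_classical all_reals all_analysis.
Export Order.TTheory GRing.Theory Num.Theory.
Export numFieldNormedType.Exports.

#[export] Set Implicit Arguments.
#[export] Unset Strict Implicit.
#[export] Unset Printing Implicit Defensive.

Local Open Scope classical_set_scope.
Local Open Scope ring_scope.

(* Functions on I = [a, b] and on [0, oo[ are total functions R -> R; every
   notion below looks only at their values on the relevant interval (up to the
   two endpoints of I, which are Lebesgue-null, for derivatives). *)

Record C2 (R : realType) (s : R -> R) : Prop := {
  C2_derivable1 : forall x, derivable s x 1;
  C2_derivable2 : forall x, derivable (derive1 s) x 1;
  C2_continuous : continuous (derive1n 2 s) }.

Record sigmoidal (R : realType) (s : R -> R) : Prop := {
  sig_measurable : measurable_fun setT s;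
  sig_cvgNy : s x @[x --> -oo] --> (0 : R);
  sig_cvgy : s x @[x --> +oo] --> (1 : R);
  sig_nondecreasing : {homo s : x y / x <= y};
  sig_lt1 : s 1 < 1;
  sig_odd : forall x, s (- x) - 2^-1 = - (s x - 2^-1);
  sig_C2 : C2 s;
  sig_concave : @convex_function R R^o `[0, +oo[ (fun x => - s x);
  sig_decay : exists2 alpha : R, 0 < alpha &
    exists C : R, \forall x \near -oo, `|s x| <= C * `|x| `^ (- alpha - 1) }.

Definition density (R : realType) (s : R -> R) (x : R) : R :=
  2^-1 * (s (x + 1) - s (x - 1)).

(* Nonnegativity on [0, oo[ follows from monotonicity and [phi 0 = 0]. *)
Record phi_function (R : realType) (phi : R -> R) : Prop := {
  phi_continuous : {within `[0, +oo[, continuous phi};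
  phi_nondecreasing : {in `[0, +oo[ &, {homo phi : u v / u <= v}};
  phi0 : phi 0 = 0;
  phi_gt0 : forall u, 0 < u -> 0 < phi u;
  phi_cvgy : phi u @[u --> +oo] --> +oo }.

Definition delta_prime (R : realType) (phi : R -> R) : Prop :=
  exists2 C : R, 0 < C &
    forall u v, 0 <= u -> 1 <= v -> phi (u * v) <= C * phi u * phi v.

Definition moment (R : realType) (phi : R -> R) (nu mu : R) (d : R -> R) :
    \bar R :=
  ereal_sup [set \esum_(k in [set: int])
      (d (u - k%:~R) * `|u - k%:~R| `^ nu * phi (`|u - k%:~R| `^ mu))%:E
    | u in [set: R]].

Section interval.
Context {R : realType} (a b : R).

Notation mu := (@lebesgue_measure R).

Definition admissible (n : nat) : Prop :=
  Num.ceil (n%:R * a) <= Num.floor (n%:R * b) - 1.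

Definition kset (n : nat) : set int :=
  [set k | Num.ceil (n%:R * a) <= k <= Num.floor (n%:R * b) - 1].

(* The supports of the two sums are subsets of the finite set [kset n], so
   these finitely supported sums are the ordinary finite ones. *)
Definition kantorovich (s : R -> R) (n : nat) (f : R -> R) (x : R) : R :=
  (\sum_(k \in kset n)
     (n%:R * Rintegral mu `[k%:~R / n%:R, (k%:~R + 1) / n%:R] f)
       * density s (n%:R * x - k%:~R))
  / (\sum_(k \in kset n) density s (n%:R * x - k%:~R)).

Definition modular (phi f : R -> R) : \bar R :=
  \int[mu]_(x in `[a, b]) (phi `|f x|)%:E.

Definition orlicz (phi f : R -> R) : Prop :=
  measurable_fun `[a, b] f /\
  exists2 lambda : R, 0 < lambda &
    (modular phi (fun x => lambda * f x)%R < +oo)%E.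

(* +oo when no u qualifies. *)
Definition luxemburg (phi f : R -> R) : \bar R :=
  ereal_inf
    [set u%:E | u in [set u : R | 0 < u /\
       (modular phi (fun x => f x / u)%R <= 1)%E]].

Definition abs_continuous (f : R -> R) : Prop :=
  forall e : R, 0 < e -> exists2 d : R, 0 < d &
    forall (m : nat) (u v : 'I_m -> R),
      (forall i, [/\ a <= u i, u i <= v i & v i <= b]) ->
      trivIset [set: 'I_m] (fun i => `]u i, v i[%classic) ->
      \sum_i (v i - u i) < d -> \sum_i `|f (v i) - f (u i)| < e.

(* The a.e. derivative of f is represented by the total function [derive1 f]: an
   absolutely continuous f is differentiable a.e. on [a, b], and values at the
   remaining points do not affect [modular]. *)
Definition sobolev_orlicz (phi f : R -> R) : Prop :=
  abs_continuous f /\ orlicz phi (derive1 f).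

End interval.

(* Main.v *)
Require Import Defs.
From mathcomp Require Import measurable_realfun ring.

Local Open Scope classical_set_scope.
Local Open Scope ring_scope.

(** Write [g := K_n f - f], [h := f'], [K := 2 L^2 / n] and [M := max 1 c]. The
    Luxemburg norm is an infimum over radii: [u > 0] is a radius for
    [h] when the modular of [h / u] is at most [1]. So the bound follows once
    multiplication by [M K] sends every radius for [h] to a radius for [g]
    ([luxemburg_le_dilation]).

    Given such a [u], the modular estimate at [lambda := 1 / (M K u)] bounds
    the modular of [g / (M K u)] by [c] times the modular of [h / (M u)]. The
    factor [c] is absorbed by convexity: as [phi 0 = 0] and [1 / M <= 1],
    [phi (t / M) <= phi t / M] ([convex_shrink]); integrating, the modular of
    [h / (M u)] is at most [1 / M] times that of [h / u]
    ([modular_shrink]), and [c / M <= 1]. *)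

(** Convexity between [t] and the zero [0] of [phi]: [s * t] is the convex
    combination of the two with weights [s] and [1 - s]. *)
Lemma convex_shrink (R : realType) (phi : R -> R) (s t : R) :
    @convex_function R R^o `[0, +oo[ phi -> phi 0 = 0 ->
    0 <= s -> s <= 1 -> 0 <= t ->
  phi (s * t) <= s * phi t.
Proof.
move=> cphi p0 s0 s1 t0.
have tD : (`[0, +oo[%classic : set R) t by rewrite /= in_itv /= t0.
have zD : (`[0, +oo[%classic : set R) 0 by rewrite /= in_itv /= lexx.
have : phi (s * t + (1 - s) * 0) <= s * phi t + (1 - s) * phi 0 :=
  cphi (Itv01 s0 s1) t 0 (mem_set tD) (mem_set zD).
by rewrite p0 !mulr0 !addr0.
Qed.

Lemma phi_function_ge0 (R : realType) (phi : R -> R) (t : R) :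
  phi_function phi -> 0 <= t -> 0 <= phi t.
Proof.
move=> hphi t0; rewrite -(phi0 hphi).
by apply: (phi_nondecreasing hphi); rewrite ?in_itv /= ?lexx ?t0.
Qed.

Lemma measurable_phi_norm (R : realType) (phi : R -> R) (D : set R)
    (g : R -> R) :
  phi_function phi -> measurable_fun D g ->
  measurable_fun D (EFin \o (fun x => phi `|g x|)).
Proof.
move=> hphi mg; apply/measurable_EFinP.
refine (measurable_comp (F := `[0, +oo[%classic : set R) (f := phi)
    (g := fun x => `|g x|) _ _ _ _) => //.
- by move=> _ [x _ <-] /=; rewrite in_itv /= normr_ge0.
- apply: subspace_continuous_measurable_fun => //; exact: phi_continuous hphi.
- exact: measurableT_comp.
Qed.

Lemma modular_shrink (R : realType) (a b : R) (phi g : R -> R) (s : R) :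
    phi_function phi -> @convex_function R R^o `[0, +oo[ phi ->
    measurable_fun `[a, b] g -> 0 <= s -> s <= 1 ->
  (modular a b phi (fun x => s * g x)%R <= s%:E * modular a b phi g)%E.
Proof.
move=> hphi cphi mg s0 s1.
have phig0 (k : R -> R) x : (0%R <= (phi `|k x|)%:E)%E.
  by rewrite lee_fin phi_function_ge0.
rewrite /modular -ge0_integralZl_EFin //; last exact: measurable_phi_norm.
apply: ge0_le_integral => //.
- apply: measurable_phi_norm => //; exact: measurable_funM.
- apply: emeasurable_funM => //; exact: measurable_phi_norm.
- move=> x _; rewrite -EFinM lee_fin normrM (ger0_norm s0).
  exact: convex_shrink cphi (phi0 hphi) s0 s1 (normr_ge0 _).
Qed.

Lemma luxemburg_le_dilation (R : realType) (a b : R) (phi g h : R -> R)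
    (k : R) :
    0 < k ->
    (forall u : R, 0 < u ->
      (modular a b phi (fun x => h x / u)%R <= 1)%E ->
      (modular a b phi (fun x => g x / (k * u))%R <= 1)%E) ->
  (luxemburg a b phi g <= k%:E * luxemburg a b phi h)%E.
Proof.
move=> k0 gh; rewrite -lee_pdivrMl //.
apply: le_ereal_inf_tmp => _ [u [u0 hu] <-].
rewrite lee_pdivrMl // -EFinM; apply: ereal_inf_lbound.
by exists (k * u) => //; split; [exact: mulr_gt0 | exact: gh].
Qed.

(** For [n = 0] the range of [k] runs from [0] to [-1]. *)
Lemma admissible_gt0 (R : realType) (a b : R) (n : nat) :
  admissible a b n -> (0 < n)%N.
Proof.
case: n => //; rewrite /admissible.
by rewrite !mul0r ceil0 floor0.
Qed.

Theorem theorem4p10 (R : realType) (a b : R) (hab : a < b)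
  (sigma : R -> R) (hsigma : sigmoidal sigma)
  (phi : R -> R) (hphi : phi_function phi)
  (hphi_convex : @convex_function R R^o `[0, +oo[ phi)
  (hphi_delta : delta_prime phi)
  (beta : R) (hbeta : 1 < beta)
  (hphi_inc : {in `]0, +oo[ &,
     {homo (fun u : R => u `^ (- beta) * phi u) : u v / u <= v}})
  (hmoment : (moment phi 0 1 (density sigma) < +oo)%E)
  (psi : R -> R) (hpsi : phi_function psi)
  (hpsi_convex :
     @convex_function R R^o `[0, +oo[ (fun x => psi x `^ beta^-1))
  (L : R) (hL : 1 <= L)
  (hequiv : forall t : R, 0 <= t -> psi (t / L) <= phi t <= psi (L * t))
  (c : R) (hc : 0 < c)
  (hmodular : forall (f : R -> R) (lambda : R) (n : nat),
     sobolev_orlicz a b phi f -> 0 < lambda -> admissible a b n ->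
     (modular a b phi
        (fun x => lambda * (kantorovich a b sigma n f x - f x))%R
      <= c%:E * modular a b phi
           (fun x => (2 * L ^+ 2 * lambda / n%:R) * derive1 f x)%R)%E)
  (f : R -> R) (n : nat)
  (hf : sobolev_orlicz a b phi f) (hn : admissible a b n) :
  (luxemburg a b phi (fun x => kantorovich a b sigma n f x - f x)%R
   <= (Num.max 1 c * (2 * L ^+ 2 / n%:R))%:E * luxemburg a b phi (derive1 f))%E.
Proof.
have n0 : 0 < n%:R :> R by rewrite ltr0n (admissible_gt0 hn).
set M : R := Num.max 1 c; set K : R := 2 * L ^+ 2 / n%:R.
have M1 : 1 <= M by rewrite le_max lexx.
have M0 : 0 < M by exact: lt_le_trans M1.
have K0 : 0 < K.
  by rewrite divr_gt0 // mulr_gt0 // exprn_gt0 // (lt_le_trans _ hL).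
apply: luxemburg_le_dilation => [|u u0 hu]; first exact: mulr_gt0.
have w0 : 0 < (M * K * u)^-1 by rewrite invr_gt0 (mulr_gt0 (mulr_gt0 M0 K0) u0).
have := hmodular f _ n hf w0 hn.
under eq_fun do rewrite mulrC.
move/le_trans; apply.
have -> : (fun x => 2 * L ^+ 2 * (M * K * u)^-1 / n%:R * derive1 f x) =
    (fun x => M^-1 * (derive1 f x / u)).
  apply/funext => x.
  have -> : 2 * L ^+ 2 * (M * K * u)^-1 / n%:R = K * (M * K * u)^-1.
    by rewrite /K mulrAC.
  by field; rewrite !gt_eqF.
have mf : measurable_fun `[a, b] (fun x => derive1 f x / u).
  by apply: measurable_funM => //; case: hf => _ [].
have Mi0 : 0 <= M^-1 by rewrite invr_ge0 ltW.
have Mi1 : M^-1 <= 1 by rewrite invf_le1.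
have := modular_shrink hphi hphi_convex mf Mi0 Mi1.
move=> hs; apply: le_trans (lee_wpmul2l _ hs) _; first by rewrite lee_fin ltW.
rewrite muleA -EFinM.
apply: (@le_trans _ _ ((c / M)%:E * 1)%E).
  by apply: lee_wpmul2l => //; rewrite lee_fin mulr_ge0 // ltW.
by rewrite mule1 lee_fin ler_pdivrMr // mul1r le_max lexx orbT.
Qed.
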